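(* Let $X$ be a finite set with $|X|\ge 2$ and let $\mathbb{M}_X$ be the free monoid with basis $X$. The arithmetical hierarchy ${\mathcal H}(\mathbb{M}_X)$ over $\mathbb{M}_X$ is proper, that is, $\Sigma_n(\mathbb{M}_X)\neq\Sigma_{n+1}(\mathbb{M}_X)$ for every $n\in\mathbb{N}$.
   Context: A formula in prenex normal form $Q_1y_1\dots Q_sy_s\,\phi_0$ ($\phi_0$ quantifier-free) is a $\Sigma_n$ formula (resp. $\Pi_n$ formula) if its quantifier sequence begins with $\exists$ (resp. $\forall$) and alternates $n-1$ times between series of existential and universal quantifiers. For a structure $\mathbb{B}$, $\Sigma_n(\mathbb{B})$ (resp. $\Pi_n(\mathbb{B})$) is the set of all subsets of $\mathbb{B}^m$, $m\in\mathbb{N}$, definable in $\mathbb{B}$ by $\Sigma_n$ (resp. $\Pi_n$) formulas $\phi(x_1,\dots,x_m)$ in the language of $\mathbb{B}$; $\Sigma_0(\mathbb{B})=\Pi_0(\mathbb{B})$ is the set of all subsets definable by quantifier-free formulas. The sets $\Sigma_n(\mathbb{B})$, $\Pi_n(\mathbb{B})$ form the arithmetical hierarchy ${\mathcal H}(\mathbb{B})$; it collapses if $\Sigma_n(\mathbb{B})=\Sigma_{n+1}(\mathbb{B})$ for some $n$, and is proper otherwise. *)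

(* Defs.v *)
From HB Require Import structures.
From mathcomp Require Import all_boot.
From mathcomp Require Import boolp classical_sets.
From mathcomp.multinomials Require monalg.

Set Implicit Arguments.
Unset Strict Implicit.
Unset Printing Implicit Defensive.

Local Open Scope classical_set_scope.

Record language := Language {
  fsym : Type;
  farity : fsym -> nat;
  rsym : Type;
  rarity : rsym -> nat
}.

Record structure (L : language) := Structure {
  carrier :> Type;
  finterp : forall f : fsym L, (farity f).-tuple carrier -> carrier;
  rinterp : forall r : rsym L, set ((rarity r).-tuple carrier)
}.

(* [term L m] and [qformula L m] have their variables among x_0, ..., x_(m-1). *)
Inductive term (L : language) (m : nat) : Type :=
| Var of 'I_m
| App (f : fsym L) of 'I_(farity f) -> term L m.

Inductive qformula (L : language) (m : nat) : Type :=
| Equal of term L m & term L m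
| Rel (r : rsym L) of 'I_(rarity r) -> term L m
| Not of qformula L m
| And of qformula L m & qformula L m
| Or of qformula L m & qformula L m.

Inductive quantifier : predArgType := Exists | Forall.

Definition is_exists (q : quantifier) : bool := if q is Exists then true else false.
Definition of_is_exists (b : bool) : quantifier := if b then Exists else Forall.
Lemma is_existsK : cancel is_exists of_is_exists. Proof. by case. Qed.
HB.instance Definition _ := Equality.copy quantifier (can_type is_existsK).

(* Prenex formulas with free variables x_0, ..., x_(m-1). Variables are de
   Bruijn indices: in [Quant q phi], the variable bound by q is x_0 of phi, and
   the free variable x_i of [Quant q phi] is x_(i+1) of phi. *)
Inductive prenex (L : language) : nat -> Type :=
| Matrix m of qformula L m : prenex L m
| Quant m of quantifier & prenex L m.+1 : prenex L m.

Fixpoint prefix L m (phi : prenex L m) : seq quantifier :=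
  match phi with
  | Matrix _ _ => [::]
  | Quant _ q psi => q :: prefix psi
  end.

Section Semantics.
Variables (L : language) (B : structure L).

Fixpoint eval m (v : m.-tuple B) (t : term L m) : B :=
  match t with
  | Var i => tnth v i
  | App f args => finterp [tuple eval v (args i) | i < farity f]
  end.

Fixpoint qholds m (v : m.-tuple B) (phi : qformula L m) : Prop :=
  match phi with
  | Equal t u => eval v t = eval v u
  | Rel r args => rinterp [tuple eval v (args i) | i < rarity r]
  | Not psi => ~ qholds v psi
  | And psi chi => qholds v psi /\ qholds v chi
  | Or psi chi => qholds v psi \/ qholds v chi
  end.

Definition quantify (q : quantifier) (P : B -> Prop) : Prop :=
  match q with
  | Exists => exists b, P b
  | Forall => forall b, P b
  end.

Fixpoint holds m (phi : prenex L m) : m.-tuple B -> Prop :=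
  match phi in prenex _ k return k.-tuple B -> Prop with
  | Matrix _ psi => fun v => qholds v psi
  | Quant _ q psi => fun v => quantify q (fun b => holds psi [tuple of b :: v])
  end.

Definition defined_set m (phi : prenex L m) : set (m.-tuple B) :=
  [set v | holds phi v].

End Semantics.

Arguments defined_set {L} B {m} phi.

(* Number of adjacent pairs of distinct quantifiers in q :: s. *)
Fixpoint alternations (q : quantifier) (s : seq quantifier) : nat :=
  if s is r :: s' then (q != r) + alternations r s' else 0.

Definition prefix_class (q : quantifier) (n : nat) (s : seq quantifier) : bool :=
  match n, s with
  | 0, [::] => true
  | n'.+1, r :: s' => (r == q) && (alternations r s' == n')
  | _, _ => false
  end.

Definition sigma_formula (n : nat) L m (phi : prenex L m) : bool :=
  prefix_class Exists n (prefix phi).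

Definition pi_formula (n : nat) L m (phi : prenex L m) : bool :=
  prefix_class Forall n (prefix phi).

Section Hierarchy.
Variables (L : language) (B : structure L).

(* The subsets of the powers B^m, for all m. *)
Definition power_subset : Type := {m : nat & set (m.-tuple B)}.

Definition Sigma (n : nat) : set power_subset :=
  [set S | exists2 phi : prenex L (tag S),
             sigma_formula n phi & tagged S = defined_set B phi].

Definition Pi (n : nat) : set power_subset :=
  [set S | exists2 phi : prenex L (tag S),
             pi_formula n phi & tagged S = defined_set B phi].

Definition hierarchy_collapses : Prop := exists n : nat, Sigma n = Sigma n.+1.

Definition hierarchy_proper : Prop := ~ hierarchy_collapses.

End Hierarchy.

Arguments Sigma {L} B n.
Arguments Pi {L} B n.

Inductive monoid_fsym := One | Mul.

Definition monoid_language : language := {|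
  fsym := monoid_fsym;
  farity f := if f is Mul then 2 else 0;
  rsym := void;
  rarity r := match r with end
|}.

(* [monalg.fmonom X] is the type of words over X, [monalg.fmone] the empty word
   and [monalg.fmmul] concatenation. The language has no constants for the
   letters. *)
Definition free_monoid (X : choiceType) : structure monoid_language := {|
  carrier := monalg.fmonom X;
  finterp f :=
    match f return (farity (l := monoid_language) f).-tuple (monalg.fmonom X) -> _ with
    | One => fun=> monalg.fmone X
    | Mul => fun t => monalg.fmmul (tnth t ord0) (tnth t ord_max)
    end;
  rinterp r := match r with end
|}.

(* Main.v *)
Require Import Defs.
From mathcomp Require Import all_boot.
From mathcomp Require Import boolp classical_sets.
From mathcomp.multinomials Require monalg.
From mathcomp Require Import zify.

(**
If Sigma_n = Sigma_(n+1), then every first-order definable set is Sigma_n, since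
Sigma_n is then closed under complements and projections. To contradict this by
diagonalization we need a definable relation that is universal for Sigma_n.

Fix two letters a <> b. A finite list of words d_1, ..., d_k is coded by the pair
of s = b a^N and q = s d_1 s ... s d_k s, where N bounds the lengths of the d_i:
since s is unbordered and longer than the d_i, the d_i are exactly the words d
without factor s such that s d s is a factor of q. Lists of words a^j b x_j then
give an analogue of Goedel's beta function, that is, a definable total function
beta(s, q, a^j) taking arbitrarily prescribed values at j = 0, ..., N. Quantifying
over (s, q) amounts to quantifying over a block of variables x_j. A matrix is
coded, via its disjunctive normal form, by a list of lists of literals of the form
x_i x_j = x_k or x_i x_j <> x_k, with auxiliary variables naming the subterms.
This yields a definable relation universal for Sigma_n, where a, b and the code
are parameters; the prefix of its definition does not matter.
*)

Set Implicit Arguments.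
Unset Strict Implicit.
Unset Printing Implicit Defensive.

(** * Prenex formulas and collapse *)

Section Prenex.
Variables (L : language) (B : structure L).

Definition pullback m k (r : 'I_m -> 'I_k) (v : k.-tuple B) : m.-tuple B :=
  [tuple tnth v (r i) | i < m].

Fixpoint rename_term m k (r : 'I_m -> 'I_k) (t : term L m) : term L k :=
  match t with
  | Var i => Var L (r i)
  | App f args => App (fun i => rename_term r (args i))
  end.

Lemma eval_rename m k (r : 'I_m -> 'I_k) (t : term L m) (v : k.-tuple B) :
  eval v (rename_term r t) = eval (pullback r v) t.
Proof.
elim: t => [i|f args IH] /=; first by rewrite tnth_mktuple.
by congr finterp; apply: eq_from_tnth => i; rewrite !tnth_mktuple IH.
Qed.

Fixpoint rename_qformula m k (r : 'I_m -> 'I_k) (phi : qformula L m) :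
    qformula L k :=
  match phi with
  | Equal t u => Equal (rename_term r t) (rename_term r u)
  | Rel R args => Rel (fun i => rename_term r (args i))
  | Not psi => Not (rename_qformula r psi)
  | And psi chi => And (rename_qformula r psi) (rename_qformula r chi)
  | Or psi chi => Or (rename_qformula r psi) (rename_qformula r chi)
  end.

Lemma qholds_rename m k (r : 'I_m -> 'I_k) (phi : qformula L m)
    (v : k.-tuple B) :
  qholds v (rename_qformula r phi) <-> qholds (pullback r v) phi.
Proof.
elim: phi => [t u|R args|psi IH|psi IH1 chi IH2|psi IH1 chi IH2] /=.
- by rewrite !eval_rename.
- suff -> : [tuple eval v (rename_term r (args i)) | i < rarity R] =
            [tuple eval (pullback r v) (args i) | i < rarity R] by [].
  by apply: eq_from_tnth => i; rewrite !tnth_mktuple eval_rename.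
- by rewrite IH.
- by rewrite IH1 IH2.
- by rewrite IH1 IH2.
Qed.

Definition lift_renaming m k (r : 'I_m -> 'I_k) (i : 'I_m.+1) : 'I_k.+1 :=
  if unlift ord0 i is Some j then lift ord0 (r j) else ord0.

Lemma pullback_lift m k (r : 'I_m -> 'I_k) (b : B) (v : k.-tuple B) :
  pullback (lift_renaming r) [tuple of b :: v] = [tuple of b :: pullback r v].
Proof.
apply: eq_from_tnth => i; rewrite tnth_mktuple /lift_renaming.
by case: unliftP => [j|] ->; rewrite ?tnthS ?tnth0 // tnth_mktuple.
Qed.

Fixpoint rename m (phi : prenex L m) : forall k, ('I_m -> 'I_k) -> prenex L k :=
  match phi in prenex _ m return forall k, ('I_m -> 'I_k) -> prenex L k with
  | Matrix _ psi => fun k r => Matrix (rename_qformula r psi)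
  | Quant _ q psi => fun k r => Quant q (rename psi (lift_renaming r))
  end.

Lemma quantify_iff q (P Q : B -> Prop) :
  (forall b, P b <-> Q b) -> quantify q P <-> quantify q Q.
Proof.
by case: q => PQ /=; split=> [H|H]; try (case: H => b /PQ; exists b);
  move=> // b; apply/PQ.
Qed.

Lemma holds_rename m (phi : prenex L m) k (r : 'I_m -> 'I_k) (v : k.-tuple B) :
  holds (rename phi r) v <-> holds phi (pullback r v).
Proof.
elim: phi k r v => {m} [m psi|m q psi IH] k r v /=; first exact: qholds_rename.
by apply: quantify_iff => b; rewrite IH pullback_lift.
Qed.

Lemma prefix_rename m (phi : prenex L m) k (r : 'I_m -> 'I_k) :
  Defs.prefix (rename phi r) = Defs.prefix phi.
Proof. by elim: phi k r => {m} [//|m q psi IH] k r /=; rewrite IH. Qed.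

Definition weaken m (phi : prenex L m) : prenex L m.+1 := rename phi (lift ord0).

Lemma pullback_behead m (b : B) (v : m.-tuple B) :
  pullback (lift ord0) [tuple of b :: v] = v.
Proof. by apply: eq_from_tnth => i; rewrite tnth_mktuple tnthS. Qed.

Lemma holds_weaken m (phi : prenex L m) (b : B) (v : m.-tuple B) :
  holds (weaken phi) [tuple of b :: v] <-> holds phi v.
Proof. by rewrite holds_rename pullback_behead. Qed.

Definition dual (q : quantifier) : quantifier := if q is Exists then Forall else Exists.

Fixpoint neg m (phi : prenex L m) : prenex L m :=
  match phi with
  | Matrix _ psi => Matrix (Not psi)
  | Quant _ q psi => Quant (dual q) (neg psi)
  end.

Lemma holds_neg m (phi : prenex L m) (v : m.-tuple B) :
  holds (neg phi) v <-> ~ holds phi v.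
Proof.
elim: phi v => {m} [m psi|m [] psi IH] v //=.
- by rewrite -forallNE; split=> H b; apply/IH/H.
- split=> [[b /IH nb] H|/existsNP[b nb]]; first by case: nb.
  by exists b; apply/IH.
Qed.

Lemma prefix_class_neg m (phi : prenex L m) q n :
  prefix_class (dual q) n (Defs.prefix (neg phi)) = prefix_class q n (Defs.prefix phi).
Proof.
have alt (k : nat) (psi : prenex L k) r :
  alternations (dual r) (Defs.prefix (neg psi)) = alternations r (Defs.prefix psi).
  elim: psi r => {k} [//|k r' psi IH] r /=; rewrite IH.
  by case: r r' => -[].
by case: n phi => [|n] [k psi|k r psi] //=; rewrite alt; case: q r => -[].
Qed.

Lemma sigma_neg n m (phi : prenex L m) : sigma_formula n (neg phi) = pi_formula n phi.
Proof. exact: (prefix_class_neg phi Forall n). Qed.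

Lemma pi_neg n m (phi : prenex L m) : pi_formula n (neg phi) = sigma_formula n phi.
Proof. exact: (prefix_class_neg phi Exists n). Qed.

(** * Closure properties of the levels of the hierarchy *)

Definition equivalent m (phi psi : prenex L m) : Prop :=
  forall v : m.-tuple B, holds phi v <-> holds psi v.

Section Inhabited.
Variable b0 : B.

Lemma quantify_const q (P : Prop) : quantify q (fun _ : B => P) <-> P.
Proof.
by case: q; split=> /=; [case|exists b0|apply|].
Qed.

Lemma quantify_and q (P : B -> Prop) (Q : Prop) :
  quantify q (fun b => P b /\ Q) <-> quantify q P /\ Q.
Proof.
case: q => /=; split.
- by move=> [b [Pb hQ]]; split=> //; exists b.
- by move=> [[b Pb] hQ]; exists b.
- by move=> H; split=> [b|]; [case: (H b)|case: (H b0)].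
- by move=> [H hQ] b.
Qed.

(** The quantifiers of [phi] are pulled out first, then those of [psi] past a quantifier-free
    conjunct. The resulting prefix is not controlled, as only definability matters. *)
Lemma holds_and m (phi psi : prenex L m) :
  exists chi : prenex L m,
    forall v : m.-tuple B, holds chi v <-> holds phi v /\ holds psi v.
Proof.
elim: phi psi => {m} [m phi psi|m q phi IH psi]; last first.
  have [chi chiP] := IH (weaken psi).
  exists (Quant q chi) => v /=; rewrite -quantify_and; apply: quantify_iff => b.
  by rewrite chiP holds_weaken.
elim: psi phi => {m} [m psi phi|m q psi IH phi].
  by exists (Matrix (And phi psi)).
have [chi chiP] := IH (rename_qformula (lift ord0) phi).
exists (Quant q chi) => v /=; rewrite and_comm -quantify_and.
apply: quantify_iff => b.
by rewrite chiP /= qholds_rename pullback_behead and_comm.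
Qed.

Lemma pi_sigmaS n m (phi : prenex L m) : pi_formula n phi ->
  exists2 psi : prenex L m, sigma_formula n.+1 psi & equivalent phi psi.
Proof.
move=> phin; exists (Quant Exists (weaken phi)); last first.
  by move=> v /=; rewrite -[X in X <-> _](quantify_const Exists);
     apply: quantify_iff => b; rewrite holds_weaken.
rewrite /sigma_formula /= prefix_rename; move: phin; rewrite /pi_formula.
by case: n (Defs.prefix phi) => [|n] [|[] s].
Qed.

(** A formula of level [n] has exactly [n] blocks, so a matrix must be padded: negate, apply the
    induction hypothesis, negate back to Pi_n and prefix a vacuous existential quantifier. *)
Lemma matrix_sigma n m (phi : qformula L m) :
  exists2 psi : prenex L m, sigma_formula n psi & equivalent (Matrix phi) psi.
Proof.
elim: n phi => [|n IH] phi; first by exists (Matrix phi).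
have [psi psin phipsi] := IH (Not phi).
have [|chi chin psichi] := @pi_sigmaS n _ (neg psi); first by rewrite pi_neg.
exists chi => // v; rewrite -psichi holds_neg -phipsi /=.
by rewrite notK.
Qed.

(** The negation of a Sigma_n formula is Pi_n, hence Sigma_(n+1), hence Sigma_n by collapse. With
    closure under existential quantification, induction on the prefix applies, reading a universal
    quantifier as not-exists-not. *)
Lemma collapse_sigma n : Sigma B n = Sigma B n.+1 ->
  forall m (phi : prenex L m),
  exists2 psi : prenex L m, sigma_formula n psi & equivalent phi psi.
Proof.
move=> coll.
have down m (phi : prenex L m) : sigma_formula n.+1 phi ->
    exists2 psi : prenex L m, sigma_formula n psi & equivalent phi psi.
  move=> phin; have : Sigma B n (existT _ m (defined_set B phi)).
    by rewrite coll; exists phi.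
  by case=> psi psin /= E; exists psi => // v;
     rewrite -[holds phi v]/(defined_set B phi v) E.
have compl m (phi : prenex L m) : sigma_formula n phi ->
    exists2 psi : prenex L m, sigma_formula n psi & equivalent (neg phi) psi.
  move=> phin; have [|psi psin E] := @pi_sigmaS n _ (neg phi).
    by rewrite pi_neg.
  by have [chi chin E'] := down _ _ psin; exists chi => // v; rewrite E E'.
have exq m (phi : prenex L m.+1) : sigma_formula n phi ->
    exists2 psi : prenex L m, sigma_formula n psi & equivalent (Quant Exists phi) psi.
  (* For [n = 0] the new quantifier leads to Sigma_1, which collapses; otherwise it merges into the
     leading existential block. *)
  case: n coll down {compl} => [|k] coll down phin.
    apply: down; move: phin; rewrite /sigma_formula /=.
    by case: (Defs.prefix phi).
  exists (Quant Exists phi) => //; move: phin; rewrite /sigma_formula /=.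
  by case: (Defs.prefix phi) => [|[] s].
move=> m phi; elim: phi => {m} [m phi|m [] phi [psi psin E]].
- exact: matrix_sigma.
- have [chi chin E'] := exq _ _ psin; exists chi => // v; rewrite -E' /=.
  by split=> -[b /E ?]; exists b.
- have [psi' psin' E1] := compl _ _ psin.
  have [chi chin E2] := exq _ _ psin'.
  have [chi' chin' E3] := compl _ _ chin.
  exists chi' => // v; rewrite -E3 holds_neg -E2 /= -forallNE.
  by split=> H b; [rewrite -E1 holds_neg notK -E|
    move: (H b); rewrite -E1 holds_neg notK -E].
Qed.
End Inhabited.
End Prenex.

(** * Definable relations on words *)

Section Definability.
Variable X : choiceType.
Notation word := (seq X).
Notation M := (free_monoid X).

Definition definable m (P : m.-tuple M -> Prop) : Prop :=
  exists phi : prenex monoid_language m, forall v : m.-tuple M, holds phi v <-> P v.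

Definition word_of (w : M) : word := monalg.fmonom_val w.

(** These are the functions given by terms; [beta] is not treated as one of them, only its graph is
    shown definable. *)
Definition definable_word m (g : m.-tuple M -> word) : Prop :=
  exists t : term monoid_language m, forall v : m.-tuple M, word_of (eval v t) = g v.

Lemma word_ofK : cancel word_of (@monalg.FMonom X).
Proof. by case. Qed.

Lemma word_of_inj : injective word_of. Proof. exact: can_inj word_ofK. Qed.

Lemma definable_word_var m (i : 'I_m) : definable_word (fun v => word_of (tnth v i)).
Proof. by exists (Var _ i). Qed.

Lemma definable_word_head m :
  definable_word (fun v : m.+1.-tuple M => word_of (thead v)).
Proof. exact: definable_word_var. Qed.

Lemma definable_word_behead m (g : m.-tuple M -> word) :
  definable_word g -> definable_word (fun v : m.+1.-tuple M => g (behead_tuple v)).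
Proof.
case=> t tP; exists (rename_term (lift ord0) t) => v.
by rewrite eval_rename [v in pullback _ v]tuple_eta pullback_behead tP.
Qed.

Lemma definable_word_nil m : definable_word (fun _ : m.-tuple M => [::]).
Proof.
exists (@App monoid_language m One (fun i : 'I_0 => False_rect _ (notF (ltn_ord i)))).
by move=> v; rewrite /word_of /= monalg.fmoneE.
Qed.

Lemma definable_word_cat m (g h : m.-tuple M -> word) :
  definable_word g -> definable_word h -> definable_word (fun v => g v ++ h v).
Proof.
move=> [t tP] [u uP].
exists (@App monoid_language m Mul (fun i : 'I_2 => if i == ord0 then t else u)).
by move=> v; rewrite /word_of /= monalg.fmmulE !tnth_mktuple /= -tP -uP.
Qed.

Lemma definable_eq m (g h : m.-tuple M -> word) :
  definable_word g -> definable_word h -> definable (fun v => g v = h v).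
Proof.
move=> [t tP] [u uP]; exists (Matrix (Equal t u)) => v /=.
by rewrite -tP -uP; split=> [->|/word_of_inj].
Qed.

Lemma definable_not m (P : m.-tuple M -> Prop) :
  definable P -> definable (fun v => ~ P v).
Proof. by case=> phi phiP; exists (neg phi) => v; rewrite holds_neg phiP. Qed.

Lemma definable_and m (P Q : m.-tuple M -> Prop) :
  definable P -> definable Q -> definable (fun v => P v /\ Q v).
Proof.
move=> [phi phiP] [psi psiP].
have [chi chiP] := holds_and (@monalg.FMonom X [::] : M) phi psi.
by exists chi => v; rewrite chiP phiP psiP.
Qed.

Lemma definable_iff m (P Q : m.-tuple M -> Prop) :
  (forall v, P v <-> Q v) -> definable P -> definable Q.
Proof. by move=> PQ [phi phiP]; exists phi => v; rewrite phiP PQ. Qed.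

Lemma definable_or m (P Q : m.-tuple M -> Prop) :
  definable P -> definable Q -> definable (fun v => P v \/ Q v).
Proof.
move=> dP dQ; apply: (@definable_iff _ (fun v => ~ (~ P v /\ ~ Q v))).
  by move=> v; rewrite -not_orE notK.
by apply: definable_not; apply: definable_and; apply: definable_not.
Qed.

Lemma definable_imply m (P Q : m.-tuple M -> Prop) :
  definable P -> definable Q -> definable (fun v => P v -> Q v).
Proof.
move=> dP dQ; apply: (@definable_iff _ (fun v => ~ (P v /\ ~ Q v))).
  by move=> v; rewrite -not_implyE notK.
by apply: definable_not; apply: definable_and => //; apply: definable_not.
Qed.

Lemma definable_ex m (P : m.-tuple M -> word -> Prop) :
  definable (fun v : m.+1.-tuple M => P (behead_tuple v) (word_of (thead v))) ->
  definable (fun v => exists x, P v x).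
Proof.
case=> phi phiP; exists (Quant Exists phi) => v /=.
have E b : behead_tuple [tuple of b :: v] = v by apply: val_inj.
split=> [[b /phiP]|[x Px]]; first by rewrite theadE E; exists (word_of b).
by exists (@monalg.FMonom X x); apply/phiP; rewrite theadE E.
Qed.

Lemma definable_all m (P : m.-tuple M -> word -> Prop) :
  definable (fun v : m.+1.-tuple M => P (behead_tuple v) (word_of (thead v))) ->
  definable (fun v => forall x, P v x).
Proof.
move=> dP; apply: (@definable_iff _ (fun v => ~ exists x, ~ P v x)).
  move=> v; rewrite -forallNE; split=> H x; last by apply; apply: H.
  by apply: contrapT; apply: H.
by apply/definable_not/definable_ex/definable_not.
Qed.

(** * Coded lists and the beta function *)

Definition mem_code (s q d : word) : Prop :=
  (exists u v, q = u ++ s ++ d ++ s ++ v) /\ ~ exists u v, d = u ++ s ++ v.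

Definition unique_entry (b s q i x : word) : Prop :=
  mem_code s q (i ++ b ++ x) /\ forall y, mem_code s q (i ++ b ++ y) -> y = x.

(** The entry [i ++ b ++ x] stores the value [x] at the key [i]. The default empty word makes the
    function total. *)
Definition beta (b s q i : word) : word :=
  xget [::] (unique_entry b s q i).

Ltac weaken_context :=
  repeat match goal with
  | H : @definable_word ?m _ |- @definable ?m.+1 _ =>
      apply definable_word_behead in H; cbv beta in H
  end;
  match goal with |- @definable ?m.+1 _ => have := definable_word_head m end.

(** Equations whose left side involves [beta] are left to dedicated lemmas, which name its values by
    quantified variables. *)
Ltac definability :=
  repeat match goal with
  | |- definable (fun v => exists x, _) =>
      apply definable_ex; cbv beta; weaken_context
  | |- definable (fun v => forall x : seq _, _) =>
      apply definable_all; cbv beta; weaken_context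
  | |- definable (fun v => _ /\ _) => apply: definable_and
  | |- definable (fun v => _ \/ _) => apply: definable_or
  | |- definable (fun v => ~ _) => apply: definable_not
  | |- definable (fun v => _ -> _) => apply: definable_imply
  | |- definable (fun v => beta _ _ _ _ = _) => fail 1
  | |- definable (fun v => beta _ _ _ _ ++ _ = _) => fail 1
  | |- definable (fun v => _ = _ :> seq _) => apply: definable_eq
  | |- definable_word (fun v => [::]) => exact: definable_word_nil
  | |- definable_word _ => assumption
  | |- definable_word (fun v => _ ++ _) => apply: definable_word_cat
  | |- definable_word _ -> _ => intro
  end.

Lemma definable_mem_code m (s q d : m.-tuple M -> word) :
  definable_word s -> definable_word q -> definable_word d ->
  definable (fun v => mem_code (s v) (q v) (d v)).
Proof. by move=> ds dq dd; rewrite /mem_code; definability. Qed.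

(** This replaces the choice operator by a first-order description of the graph. *)
Lemma betaP b s q i x : beta b s q i = x <->
  unique_entry b s q i x \/ x = [::] /\ ~ exists y, unique_entry b s q i y.
Proof.
have uniq y z : unique_entry b s q i y -> unique_entry b s q i z -> z = y.
  by move=> [_ Uy] [zq _]; apply: Uy.
rewrite /beta; case: xgetP => [y _ yP|none]; last first.
  split=> [<-|]; first by right; split=> // -[y]; apply: none.
  by case=> [/none|[->]].
split=> [<-|]; first by left.
by case=> [/uniq|[_ []]]; [apply|exists y].
Qed.

Lemma definable_unique_entry m (b s q i x : m.-tuple M -> word) :
  definable_word b -> definable_word s -> definable_word q ->
  definable_word i -> definable_word x ->
  definable (fun v => unique_entry (b v) (s v) (q v) (i v) (x v)).
Proof.
move=> db ds dq di dx; rewrite /unique_entry; definability.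
all: apply: definable_mem_code; definability.
Qed.

Lemma definable_beta m (b s q i x : m.-tuple M -> word) :
  definable_word b -> definable_word s -> definable_word q ->
  definable_word i -> definable_word x ->
  definable (fun v => beta (b v) (s v) (q v) (i v) = x v).
Proof.
move=> db ds dq di dx.
apply: definable_iff; first by move=> v; apply: iff_sym; exact: betaP.
definability; apply: definable_unique_entry; definability.
Qed.

Lemma definable_beta_eq m (b s q i s' q' i' : m.-tuple M -> word) :
  definable_word b -> definable_word s -> definable_word q -> definable_word i ->
  definable_word s' -> definable_word q' -> definable_word i' ->
  definable (fun v => beta (b v) (s v) (q v) (i v) = beta (b v) (s' v) (q' v) (i' v)).
Proof.
move=> db ds dq di ds' dq' di'.
apply: (@definable_iff _ (fun v => exists x,
  beta (b v) (s v) (q v) (i v) = x /\ beta (b v) (s' v) (q' v) (i' v) = x)).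
  by move=> v; split=> [[x [-> ->]]|->] //; eexists.
definability; apply: definable_beta; definability.
Qed.

Lemma definable_beta_cat m (b s q i j k : m.-tuple M -> word) :
  definable_word b -> definable_word s -> definable_word q ->
  definable_word i -> definable_word j -> definable_word k ->
  definable (fun v => beta (b v) (s v) (q v) (i v) ++ beta (b v) (s v) (q v) (j v) =
                      beta (b v) (s v) (q v) (k v)).
Proof.
move=> db ds dq di dj dk.
apply: (@definable_iff _ (fun v => exists x y,
  beta (b v) (s v) (q v) (i v) = x /\ beta (b v) (s v) (q v) (j v) = y /\
  beta (b v) (s v) (q v) (k v) = x ++ y)).
  by move=> v; split=> [[x [y [-> [-> ->]]]]|E] //; eexists; eexists.
definability; apply: definable_beta; definability.
Qed.

(** * Truth of coded formulas *)

Fixpoint pow (a : word) (n : nat) : word := if n is n'.+1 then a ++ pow a n' else [::].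

Lemma definable_word_pow m (a : m.-tuple M -> word) n :
  definable_word a -> definable_word (fun v => pow (a v) n).
Proof. by move=> da; elim: n => [|n IH] /=; definability. Qed.

(** When [c] is the power a^m of a letter [a], the words [i] are the a^j with j < m, so this is a
    bounded quantification over the first m variables. *)
Definition agree (a b c s q s' q' : word) : Prop :=
  forall i z, c = i ++ a ++ z -> beta b s' q' i = beta b s q i.

(* For a letter [a], [i ++ a = a ++ i] says that [i] is a power of [a]. *)
Definition literal_true (a b s q l : word) : Prop :=
  exists i j k, (i ++ a = a ++ i /\ j ++ a = a ++ j /\ k ++ a = a ++ k) /\
    (l = i ++ b ++ j ++ b ++ k /\ beta b s q i ++ beta b s q j = beta b s q k \/
     l = b ++ i ++ b ++ j ++ b ++ k /\
       beta b s q i ++ beta b s q j <> beta b s q k).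

(** Two levels of coding: [(s1, e)] codes the list of clauses, and each clause, read with the
    separator [s2], is a list of literals. *)
Definition dnf_true (a b s1 s2 e s q : word) : Prop :=
  exists d, mem_code s1 e d /\ forall l, mem_code s2 d l -> literal_true a b s q l.

Lemma definable_agree m (a b c s q s' q' : m.-tuple M -> word) :
  definable_word a -> definable_word b -> definable_word c ->
  definable_word s -> definable_word q -> definable_word s' -> definable_word q' ->
  definable (fun v => agree (a v) (b v) (c v) (s v) (q v) (s' v) (q' v)).
Proof.
move=> da db dc ds dq ds' dq'; rewrite /agree; definability.
apply: definable_beta_eq; definability.
Qed.

Lemma definable_literal_true m (a b s q l : m.-tuple M -> word) :
  definable_word a -> definable_word b -> definable_word s -> definable_word q ->
  definable_word l ->
  definable (fun v => literal_true (a v) (b v) (s v) (q v) (l v)).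
Proof.
move=> da db ds dq dl; rewrite /literal_true; definability.
all: apply: definable_beta_cat; definability.
Qed.

Lemma definable_dnf_true m (a b s1 s2 e s q : m.-tuple M -> word) :
  definable_word a -> definable_word b -> definable_word s1 -> definable_word s2 ->
  definable_word e -> definable_word s -> definable_word q ->
  definable (fun v => dnf_true (a v) (b v) (s1 v) (s2 v) (e v) (s v) (q v)).
Proof.
move=> da db ds1 ds2 de ds dq; rewrite /dnf_true; definability.
- by apply: definable_mem_code; definability.
- by apply: definable_mem_code; definability.
- by apply: definable_literal_true; definability.
Qed.

(* The pair [(cs, cq)] codes a Sigma_n formula: the values of [beta] at [1], [a]
   and [a ^ 2] code its matrix, and the value [a ^ m] at [a ^ (k + 3)] records
   that [m] variables are in scope when [k] blocks of quantifiers are left. *)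
Fixpoint universal (n : nat) (a b cs cq s q : word) : Prop :=
  exists c s' q', beta b cs cq (pow a n.+3) = c /\ agree a b c s q s' q' /\
  if n is n'.+1 then ~ universal n' a b cs cq s' q'
  else exists s1 s2 e, beta b cs cq [::] = s1 /\ beta b cs cq a = s2 /\
    beta b cs cq (a ++ a) = e /\ dnf_true a b s1 s2 e s' q'.

Lemma definable_universal n m (a b cs cq s q : m.-tuple M -> word) :
  definable_word a -> definable_word b -> definable_word cs -> definable_word cq ->
  definable_word s -> definable_word q ->
  definable (fun v => universal n (a v) (b v) (cs v) (cq v) (s v) (q v)).
Proof.
elim: n m a b cs cq s q => [|n IH] m a b cs cq s q da db dcs dcq ds dq /=;
  definability.
all: try by (apply: definable_beta; definability; apply: definable_word_pow).
all: try by (apply: definable_agree; definability).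
- by apply: definable_dnf_true; definability.
- by apply: IH; definability.
Qed.

(* The assignment [(s, q)] gives [x_0, x_1, x_2, x_3] the values [a, b, cs, cq]; the
   variable [x_i] is stored at [a ^ (3 - i)], see [tuple_of_env]. *)
Definition diagonal n (a b cs cq : word) : Prop :=
  exists s q, (beta b s q (a ++ a ++ a) = a /\ beta b s q (a ++ a) = b /\
    beta b s q a = cs /\ beta b s q [::] = cq) /\
    ~ universal n a b cs cq s q.

Lemma definable_diagonal n m (a b cs cq : m.-tuple M -> word) :
  definable_word a -> definable_word b -> definable_word cs -> definable_word cq ->
  definable (fun v => diagonal n (a v) (b v) (cs v) (cq v)).
Proof.
move=> da db dcs dcq; rewrite /diagonal; definability.
all: try by (apply: definable_beta; definability).
by apply: definable_universal; definability.
Qed.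

(** * Coding lists and assignments *)

Section Coding.
Variables (a b : X) (ab : a != b).

Notation run n := (nseq n a).

Definition separator (N : nat) : word := b :: run N.

Definition encode (N : nat) (ds : seq word) : word :=
  foldr (fun d e => separator N ++ d ++ e) (separator N) ds.

(** At position [size t] the left side has an [a] of the run, the right side the [b] opening its
    separator. *)
Lemma separator_unbordered N t y z :
  t != [::] -> size t <= N -> separator N ++ y <> t ++ separator N ++ z.
Proof.
case: t => [//|c t] _ /= tN [_ E].
have := congr1 (nth a ^~ (size t)) E.
rewrite !nth_cat size_nseq tN nth_nseq tN ltnn subnn /= => /eqP.
by rewrite (negPf ab).
Qed.

(** One case of Levi's lemma for words. *)
Lemma cat_split (u v y z : word) : u ++ v = y ++ z -> size y <= size u ->
  exists2 w, u = y ++ w & z = w ++ v.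
Proof.
move=> E le; have T : take (size y) u = y.
  by have := congr1 (take (size y)) E; rewrite takel_cat // take_size_cat.
have uE : u = y ++ drop (size y) u by rewrite -[LHS](cat_take_drop (size y)) T.
by exists (drop (size y) u) => //; move/eqP: E; rewrite {1}uE -catA eqseq_cat // =>
  /andP[_ /eqP].
Qed.

(* Since [d1] is shorter than the separator and the separator is unbordered,
   the separator following [d1] is its first occurrence. *)
Lemma separator_first N d1 t y z : size d1 <= N -> size t < size d1 ->
  d1 ++ separator N ++ y <> t ++ separator N ++ z.
Proof.
move=> d1N td E.
have [w d1E wE] := cat_split E (ltnW td).
apply: (@separator_unbordered N w z y) => //.
  by apply: contraTneq td => w0; rewrite d1E w0 cats0 ltnn.
by apply: leq_trans d1N; rewrite d1E size_cat leq_addl.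
Qed.

Lemma encode_prefix N ds : exists z, encode N ds = separator N ++ z.
Proof. by case: ds => [|d ds]; [exists [::]; rewrite cats0|eexists]. Qed.

Lemma mem_codeP N ds : {in ds, forall d, size d <= N} ->
  forall d, mem_code (separator N) (encode N ds) d <-> d \in ds.
Proof.
move=> dsN d; split; last first.
  move=> dds; split; last first.
    move=> [u [v E]]; have := dsN _ dds.
    by rewrite E !size_cat /= size_nseq addnCA leqNgt ltnS leq_addr.
  elim: ds {dsN} dds => [//|d1 ds IH]; rewrite inE => /predU1P[->|/IH[u [v E]]].
    by have [z eE] := encode_prefix N ds; exists [::], z; rewrite /= -/(encode N ds) eE.
  by exists (separator N ++ d1 ++ u), v; rewrite /= -/(encode N ds) E -!catA.
case=> -[u [v E]] free; elim: ds dsN u E => [|d1 ds IH] dsN u E.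
  move: (congr1 size E); rewrite !size_cat /=; lia.
have d1N : size d1 <= N by apply: dsN; rewrite mem_head.
have {}IH := IH (fun d dds => dsN d (mem_behead (s := d1 :: ds) dds)).
have [z eE] := encode_prefix N ds.
rewrite inE.
have {}E : separator N ++ d1 ++ encode N ds = u ++ separator N ++ d ++ separator N ++ v.
  exact: E.
(* If the occurrence starts at the first separator, then [d] is [d1]: a shorter [d] would put a
   separator too early, a longer one would contain a separator or overlap one. *)
have [u0|uN0] := eqVneq u [::].
  have {}E : d1 ++ encode N ds = d ++ separator N ++ v.
    by move: E; rewrite u0 => -[] /eqP; rewrite eqseq_cat // eqxx => /eqP.
  rewrite eE in E; have [lt|gt|eqs] := ltngtP (size d) (size d1).
  - by case: (separator_first d1N lt E).
  - have [w dE wE] := cat_split (esym E) (ltnW gt).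
    have [ltw|gew] := leqP (size w) N; last first.
      have [|w' w'E _] := cat_split (esym wE); first by rewrite /= size_nseq.
      by case: free; exists d1, w'; rewrite dE w'E.
    case: (@separator_unbordered N w z v) => //.
    by apply: contraTneq gt => w0; rewrite dE w0 cats0 ltnn.
  - by move/eqP: E; rewrite eqseq_cat ?eqs // => /andP[/eqP->]; rewrite eqxx.
(* Otherwise the occurrence can start neither inside the first separator nor inside [d1], so it lies
   in the code of the tail. *)
have [uN|Nu] := leqP (size u) N.
  by case: (separator_unbordered uN0 uN E).
have [|u1 uE u1E] := cat_split (y := separator N) (esym E); first by rewrite /= size_nseq.
have [lt|ge] := ltnP (size u1) (size d1).
  by rewrite eE in u1E; case: (separator_first d1N lt u1E).
have [u2 _ u2E] := cat_split (esym u1E) ge.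
by rewrite (IH _ u2E) orbT.
Qed.

Lemma size_bound (ds : seq word) : exists N, {in ds, forall d, size d <= N}.
Proof.
elim: ds => [|d ds [N dsN]]; first by exists 0.
exists (maxn (size d) N) => c; rewrite inE leq_max => /predU1P[->|/dsN ->].
  by rewrite leqnn.
by rewrite orbT.
Qed.

Lemma run_inj i j x y : run i ++ b :: x = run j ++ b :: y -> i = j /\ x = y.
Proof.
elim: i j => [|i IH] [|j] /=; first by case.
- by case=> ba; move: ab; rewrite ba eqxx.
- by case=> ba; move: ab; rewrite ba eqxx.
- by case=> /IH[-> ->].
Qed.

Lemma commute_run x : x ++ [:: a] = [:: a] ++ x -> x = run (size x).
Proof. by elim: x => [//|c x IH] /= [-> E]; rewrite -IH. Qed.

Definition env (s q : word) (j : nat) : word := beta [:: b] s q (run j).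

(** Code the list of the words a^j b f(j). The first [b] of an entry ends its key, so key and value
    are determined even if f(j) contains [b]. *)
Lemma env_surj N (f : nat -> word) :
  exists s q, forall j, j < N -> env s q j = f j.
Proof.
pose ds := [seq run j ++ b :: f j | j <- iota 0 N].
have [K dsK] := size_bound ds.
exists (separator K), (encode K ds) => j jN; apply/betaP; left; split.
  by apply/mem_codeP => //; apply: map_f; rewrite mem_iota.
by move=> y /(mem_codeP dsK)/mapP[k _ /run_inj[-> ->]].
Qed.

Lemma agreeP m s q s' q' : agree [:: a] [:: b] (run m) s q s' q' <->
  forall j, j < m -> env s' q' j = env s q j.
Proof.
split=> [H j jm|H i z E].
  apply: (H _ (run (m - j.+1))).
  by rewrite /= -[a :: _]/(run (m - j.+1).+1) -nseqD; congr nseq; lia.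
have im : size i < m by move: (congr1 size E); rewrite size_nseq !size_cat /=; lia.
have -> : i = run (size i).
  by have := congr1 (take (size i)) E; rewrite take_size_cat // take_nseq // ltnW.
exact: H.
Qed.

(* [(sg, i, j, k)] stands for [x_i x_j = x_k] if [sg], for its negation otherwise. *)
Definition literal : Type := bool * nat * nat * nat.

Definition literal_sat (f : nat -> word) (l : literal) : Prop :=
  let: (sg, i, j, k) := l in if sg then f i ++ f j = f k else f i ++ f j <> f k.

Definition literal_code (l : literal) : word :=
  let: (sg, i, j, k) := l in
  (if sg then [::] else [:: b]) ++ run i ++ b :: run j ++ b :: run k.

Lemma literal_trueP s q l :
  literal_true [:: a] [:: b] s q (literal_code l) <-> literal_sat (env s q) l.
Proof.
have ba : b == a = false by rewrite eq_sym; apply: negbTE.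
case: l => [[[sg i] j] k]; split; last first.
  have C n : run n ++ [:: a] = [:: a] ++ run n.
    by elim: n => [//|n IH] /=; rewrite IH.
  by case: sg => H; exists (run i), (run j), (run k); split; [|left| |right].
move=> [i' [j' [k' [[/commute_run-> [/commute_run-> /commute_run->]] H]]]].
case: H => -[E H].
(* The number of letters [b] reveals the sign: two in a positive code, three in a negative one. *)
- have := congr1 (count_mem b) E.
  case: sg E => /= E; do 4!rewrite ?(count_cat, count_nseq, eqxx, negPf ab, mul0n) //=.
  move=> _; case/run_inj: E => -> /run_inj[-> /(congr1 size)].
  by rewrite !size_nseq => ->.
- have := congr1 (count_mem b) E.
  case: sg E => /= E; do 4!rewrite ?(count_cat, count_nseq, eqxx, negPf ab, mul0n) //=.
  move=> _; case: E => /run_inj[-> /run_inj[-> /(congr1 size)]].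
  by rewrite !size_nseq => ->.
Qed.

Definition clause_sat (f : nat -> word) (c : seq literal) : Prop :=
  {in c, forall l, literal_sat f l}.

Definition dnf_sat (f : nat -> word) (D : seq (seq literal)) : Prop :=
  exists2 c, c \in D & clause_sat f c.

(** The bound [N2] is taken over the literals of all clauses, so that a single inner separator
    serves every clause. *)
Lemma dnf_trueP (D : seq (seq literal)) : exists s1 s2 e, forall s q,
  dnf_true [:: a] [:: b] s1 s2 e s q <-> dnf_sat (env s q) D.
Proof.
have [N2 codeN] := size_bound (map literal_code (flatten D)).
pose clause_code c := encode N2 (map literal_code c).
have [N1 clauseN] := size_bound (map clause_code D).
have clauseP c d : c \in D ->
    mem_code (separator N2) (clause_code c) d <-> d \in map literal_code c.
  move=> cD; apply: mem_codeP => x /mapP[l lc ->]; apply: codeN.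
  by apply: map_f; apply/flattenP; exists c.
exists (separator N1), (separator N2), (encode N1 (map clause_code D)) => s q.
split=> [[d [/(mem_codeP clauseN)/mapP[c cD ->] H]]|[c cD H]].
  by exists c => // l lc; apply/literal_trueP/H/(clauseP _ _ cD)/map_f.
exists (clause_code c); split; first by apply/(mem_codeP clauseN)/map_f.
by move=> _ /(clauseP _ _ cD)/mapP[l lc ->]; apply/literal_trueP/H.
Qed.

Definition agree_below (n : nat) (f g : nat -> word) : Prop :=
  forall j, j < n -> f j = g j.

(* The de Bruijn variable [x_i] of a formula in [m] variables is stored at
   [m - 1 - i], a position which does not change under quantifiers. *)
Definition tuple_of_env m (f : nat -> word) : m.-tuple M :=
  [tuple (@monalg.FMonom X (f (m - i.+1)) : M) | i < m].

Lemma eq_tuple_of_env m f g : agree_below m f g -> tuple_of_env m f = tuple_of_env m g.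
Proof.
move=> fg; apply: eq_from_tnth => i; rewrite !tnth_mktuple fg //.
by have := ltn_ord i; lia.
Qed.

Lemma cons_tuple_of_env m f g (w : M) : agree_below m f g -> g m = word_of w ->
  [tuple of w :: tuple_of_env m f] = tuple_of_env m.+1 g.
Proof.
move=> /eq_tuple_of_env fg gm; apply: eq_from_tnth => i; rewrite tnth_mktuple.
case: (unliftP ord0 i) => [j|] ->; last by rewrite tnth0 subn1 /= gm word_ofK.
by rewrite tnthS fg tnth_mktuple.
Qed.

(** * Matrices in disjunctive normal form *)

Lemma agree_belowW m n f g : m <= n -> agree_below n f g -> agree_below m f g.
Proof. by move=> mn fg j jm; apply: fg; apply: leq_trans mn. Qed.

Lemma agree_below_trans n f g h :
  agree_below n f g -> agree_below n g h -> agree_below n f h.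
Proof. by move=> fg gh j jn; rewrite fg ?gh. Qed.

Lemma agree_below_sym n f g : agree_below n f g -> agree_below n g f.
Proof. by move=> fg j jn; rewrite fg. Qed.

Definition update (f : nat -> word) (n : nat) (w : word) (j : nat) : word :=
  if j == n then w else f j.

Lemma agree_below_update n f w : agree_below n f (update f n w).
Proof. by move=> j jn; rewrite /update ltn_eqF. Qed.

Lemma clause_sat_cat f c d : clause_sat f (c ++ d) <-> clause_sat f c /\ clause_sat f d.
Proof.
split=> [H|[Hc Hd] l]; last by rewrite mem_cat => /orP[/Hc|/Hd].
by split=> l lc; apply: H; rewrite mem_cat lc ?orbT.
Qed.

Lemma clause_sat1 f l : clause_sat f [:: l] <-> literal_sat f l.
Proof.
by split=> [H|H k]; [apply: H; rewrite mem_head|rewrite mem_seq1 => /eqP->].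
Qed.

(* The clause [c] uses auxiliary variables with indices in [N, N'). *)
Lemma term_clause m (t : term monoid_language m) N : m <= N ->
  exists c r N', [/\ N <= N',
    forall f, clause_sat f c -> f r = word_of (eval (tuple_of_env m f) t) &
    forall f, exists2 f', agree_below N f f' &
      forall g, agree_below N' f' g -> clause_sat g c].
Proof.
elim: t N => [i|[] args IH] N mN.
- exists [::], (m - i.+1), N; split=> // f; last by exists f.
  by rewrite /= tnth_mktuple.
(* The literal x_N x_N = x_N forces x_N to be empty. *)
- exists [:: (true, N, N, N)], N, N.+1; split=> [//|f|f].
    move=> /clause_sat1 /= /(congr1 size) E.
    by rewrite /word_of monalg.fmoneE; apply: size0nil; move: E; rewrite size_cat; lia.
  exists (update f N [::]); first exact: agree_below_update.
  by move=> g fg; apply/clause_sat1; rewrite /= -fg // /update eqxx.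
have [c1 [r1 [N1 [NN1 c1E c1S]]]] := IH ord0 N mN.
have [c2 [r2 [N2 [NN2 c2E c2S]]]] := IH ord_max N1 (leq_trans mN NN1).
exists (c1 ++ c2 ++ [:: (true, r1, r2, N2)]), N2, N2.+1; split=> [|f|f].
- by rewrite (leq_trans NN1) // (leq_trans NN2).
- move=> /clause_sat_cat[/c1E f1 /clause_sat_cat[/c2E f2 /clause_sat1 /= <-]].
  by rewrite f1 f2 /word_of monalg.fmmulE !tnth_mktuple.
have [f1 ff1 f1S] := c1S f; have [f2 ff2 f2S] := c2S f1.
(* The arguments may be evaluated under the original [f], since all later changes occur at indices
   [N >= m] or above. *)
pose w i := word_of (eval (tuple_of_env m f) (args i)).
have f3E : agree_below N2 f2 (update f2 N2 (w ord0 ++ w ord_max)).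
  exact: agree_below_update.
have ff2N : agree_below N f f2.
  by apply: agree_below_trans ff1 _; apply: agree_belowW ff2.
exists (update f2 N2 (w ord0 ++ w ord_max)).
  by apply: agree_below_trans ff2N _; apply: agree_belowW f3E; apply: leq_trans NN2.
move=> g gE; have f2g : agree_below N2 f2 g.
  by apply: agree_below_trans f3E _; apply: agree_belowW gE.
have g1 : clause_sat g c1.
  by apply: f1S; apply: agree_below_trans ff2 _; apply: agree_belowW f2g.
have g2 : clause_sat g c2 by apply: f2S.
apply/clause_sat_cat; split=> //; apply/clause_sat_cat; split=> //.
apply/clause_sat1; rewrite /= (c1E _ g1) (c2E _ g2) -gE // /update eqxx /w.
rewrite (@eq_tuple_of_env m f g) //; apply: agree_below_trans (agree_belowW mN ff2N) _.
by apply: agree_belowW f2g; rewrite (leq_trans mN) // (leq_trans NN1).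
Qed.

(* [P] is equivalent to a disjunctive normal form, up to auxiliary variables
   which may be chosen beyond any given bound. *)
Definition has_dnf m (P : (nat -> word) -> Prop) : Prop :=
  forall N, m <= N -> exists D N', [/\ N <= N',
    forall f, dnf_sat f D -> P f &
    forall f, P f -> exists2 f', agree_below N f f' &
      forall g, agree_below N' f' g -> dnf_sat g D].

Lemma has_dnf_iff m (P Q : (nat -> word) -> Prop) :
  (forall f, P f <-> Q f) -> has_dnf m P -> has_dnf m Q.
Proof.
move=> PQ dP N mN; have [D [N' [NN' DP PD]]] := dP N mN.
by exists D, N'; split=> // f; [move/DP/PQ|move/PQ/PD].
Qed.

(** Conjunction distributes over the clauses. The auxiliary variables of [Q] are chosen after those
    of [P], so [Q] must survive changes at indices from [m] on. *)
Lemma has_dnf_and m (P Q : (nat -> word) -> Prop) :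
  (forall f g, agree_below m f g -> Q f -> Q g) ->
  has_dnf m P -> has_dnf m Q -> has_dnf m (fun f => P f /\ Q f).
Proof.
move=> Qloc dP dQ N mN; have [D1 [N1 [NN1 DP PD]]] := dP N mN.
have [D2 [N2 [NN2 DQ QD]]] := dQ N1 (leq_trans mN NN1).
exists [seq c1 ++ c2 | c1 <- D1, c2 <- D2], N2; split=> [|f|f].
- exact: leq_trans NN2.
- move=> [_ /allpairsP[[c1 c2] [/= c1D c2D ->]] /clause_sat_cat[c1f c2f]].
  by split; [apply: DP; exists c1|apply: DQ; exists c2].
move=> [/PD[f1 ff1 f1D] Qf].
have [f2 ff2 f2D] := QD f1 (Qloc _ _ (agree_belowW mN ff1) Qf).
exists f2; first by apply: agree_below_trans ff1 _; apply: agree_belowW ff2.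
move=> g fg; have [c2 c2D c2g] := f2D g fg.
have [|c1 c1D c1g] := f1D g.
  by apply: agree_below_trans ff2 _; apply: agree_belowW fg.
exists (c1 ++ c2); first by apply/allpairsP; exists (c1, c2).
by apply/clause_sat_cat.
Qed.

Lemma has_dnf_or m (P Q : (nat -> word) -> Prop) :
  has_dnf m P -> has_dnf m Q -> has_dnf m (fun f => P f \/ Q f).
Proof.
move=> dP dQ N mN; have [D1 [N1 [NN1 DP PD]]] := dP N mN.
have [D2 [N2 [NN2 DQ QD]]] := dQ N1 (leq_trans mN NN1).
exists (D1 ++ D2), N2; split=> [|f|f].
- exact: leq_trans NN2.
- move=> [c]; rewrite mem_cat => /orP[cD|cD] cf; [left; apply: DP|right; apply: DQ].
    by exists c.
  by exists c.
move=> [/PD|/QD] [f' ff' f'D]; exists f'; try by [apply: agree_belowW ff'|].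
- move=> g fg; have [|c cD cg] := f'D g; first exact: agree_belowW fg.
  by exists c => //; rewrite mem_cat cD.
- move=> g fg; have [c cD cg] := f'D g fg.
  by exists c => //; rewrite mem_cat cD orbT.
Qed.

(** A fresh variable x_N2 is forced to be empty; then x_N2 x_r1 = x_r2, or its negation, compares
    the values of the two terms in the format of a literal. *)
Lemma has_dnf_equal m (t u : term monoid_language m) (sg : bool) :
  has_dnf m (fun f => let E := eval (tuple_of_env m f) t = eval (tuple_of_env m f) u in
                      if sg then E else ~ E).
Proof.
move=> N mN; have [c1 [r1 [N1 [NN1 c1E c1S]]]] := term_clause t mN.
have [c2 [r2 [N2 [NN2 c2E c2S]]]] := term_clause u (leq_trans mN NN1).
pose c := [:: (true, N2, N2, N2)] ++ [:: (sg, N2, r1, r2)].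
have cP f : clause_sat f c1 -> clause_sat f c2 -> clause_sat f c <-> f N2 = [::] /\
    let E := eval (tuple_of_env m f) t = eval (tuple_of_env m f) u in if sg then E else ~ E.
  move=> /c1E f1 /c2E f2; rewrite /c clause_sat_cat !clause_sat1 /=.
  have -> : f N2 ++ f N2 = f N2 <-> f N2 = [::].
    split=> [/(congr1 size)|->//]; rewrite size_cat => E; apply: size0nil; lia.
  split=> -[f0]; rewrite f0 /= f1 f2.
    by case: {c} sg => [/word_of_inj|H] //; split=> // E; apply: H; rewrite E.
  by case: {c} sg => [->|H] //; split=> // /word_of_inj.
exists [:: c1 ++ c2 ++ c], N2.+1; split=> [|f|f].
- by rewrite (leq_trans NN1) // (leq_trans NN2).
- move=> [d]; rewrite mem_seq1 => /eqP-> /clause_sat_cat[f1 /clause_sat_cat[f2]].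
  by move/(cP _ f1 f2) => [].
move=> Pf; have [f1 ff1 f1S] := c1S f; have [f2 ff2 f2S] := c2S f1.
have f3E : agree_below N2 f2 (update f2 N2 [::]) by exact: agree_below_update.
have ff2N : agree_below N f f2.
  by apply: agree_below_trans ff1 _; apply: agree_belowW ff2.
exists (update f2 N2 [::]).
  by apply: agree_below_trans ff2N _; apply: agree_belowW f3E; apply: leq_trans NN2.
move=> g gE; have f2g : agree_below N2 f2 g.
  by apply: agree_below_trans f3E _; apply: agree_belowW gE.
have g1 : clause_sat g c1.
  by apply: f1S; apply: agree_below_trans ff2 _; apply: agree_belowW f2g.
have g2 : clause_sat g c2 by apply: f2S.
exists (c1 ++ c2 ++ c); first by rewrite mem_head.
apply/clause_sat_cat; split=> //; apply/clause_sat_cat; split=> //.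
apply/(cP _ g1 g2); split; first by rewrite -gE // /update eqxx.
rewrite -(@eq_tuple_of_env m f g) //; apply: agree_below_trans (agree_belowW mN ff2N) _.
by apply: agree_belowW f2g; rewrite (leq_trans mN) // (leq_trans NN1).
Qed.

(** The sign [sg] pushes negations down to the atoms by De Morgan's laws. *)
Lemma has_dnf_qformula m (phi : qformula monoid_language m) (sg : bool) :
  has_dnf m (fun f => if sg then qholds (tuple_of_env m f) phi
                      else ~ qholds (tuple_of_env m f) phi).
Proof.
have loc (psi : qformula monoid_language m) (s : bool) f g : agree_below m f g ->
    (if s then qholds (tuple_of_env m f) psi else ~ qholds (tuple_of_env m f) psi) ->
    if s then qholds (tuple_of_env m g) psi else ~ qholds (tuple_of_env m g) psi.
  by move/eq_tuple_of_env->.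
elim: phi sg => [t u|[]|psi IH|psi IH1 chi IH2|psi IH1 chi IH2] sg.
- exact: has_dnf_equal.
- by case: sg (IH (~~ sg)) => //; apply: has_dnf_iff => f /=; rewrite notK.
- case: sg => /=; first by apply: has_dnf_and (IH1 true) (IH2 true); apply: (loc chi true).
  apply: has_dnf_iff (has_dnf_or (IH1 false) (IH2 false)) => f.
  by rewrite not_andE.
- case: sg => /=; first exact: has_dnf_or (IH1 true) (IH2 true).
  have := has_dnf_and (loc chi false) (IH1 false) (IH2 false).
  by apply: has_dnf_iff => f; rewrite not_orE.
Qed.

(** * The universal relation and the diagonal *)

Lemma holds_exists_env m (phi : prenex monoid_language m.+1) f :
  holds (Quant Exists phi) (tuple_of_env m f) <->
  exists2 f', agree_below m f f' & holds phi (tuple_of_env m.+1 f').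
Proof.
split=> /= [[w H]|[f' ff' H]]; last first.
  by exists (@monalg.FMonom X (f' m)); rewrite (cons_tuple_of_env ff').
exists (update f m (word_of w)); first exact: agree_below_update.
rewrite -(@cons_tuple_of_env _ f _ w) ?/update ?eqxx //; exact: agree_below_update.
Qed.

(** A single choice of [f'] supplies the values of a whole existential block of any length; hence
    one pair of words per block suffices in [universal]. *)
Lemma first_block n m (phi : prenex monoid_language m) : sigma_formula n.+1 phi ->
  exists m' (psi : prenex monoid_language m'), [/\ m <= m', pi_formula n psi &
    forall f, holds phi (tuple_of_env m f) <->
      exists2 f', agree_below m f f' & holds psi (tuple_of_env m' f')].
Proof.
elim: phi => {m} [//|m q phi IH].
move=> /andP[/eqP-> alt].
(* Either the existential block continues, or what remains is Pi_n. *)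
have [s1|/negP s1] := boolP (sigma_formula n.+1 phi).
  have [m' [psi [mm' psin H]]] := IH s1.
  exists m', psi; split=> [|//|f]; first exact: ltnW.
  rewrite holds_exists_env; split=> [[f' ff' /H[f'' ff'' Hf]]|[f' ff' Hf]].
    by exists f'' => //; apply: agree_below_trans ff' _; apply: agree_belowW ff''.
  by exists f' => //; apply/H; exists f'.
exists m.+1, phi; split=> // [|f]; last exact: holds_exists_env.
have {alt} : alternations Exists (Defs.prefix phi) == n := alt.
move: s1; rewrite /sigma_formula /pi_formula.
by case: (Defs.prefix phi) => [|[] s] //=; case: n {IH} => [|n].
Qed.

Lemma powE n : pow [:: a] n = run n.
Proof. by elim: n => //= n ->. Qed.

(** After the first block is removed, the negation of the Pi_n remainder is Sigma_n, and the
    negation in [universal] undoes this one. *)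
Lemma universalP n m (phi : prenex monoid_language m) : sigma_formula n phi ->
  exists g, forall cs cq, agree_below n.+4 g (env cs cq) -> forall s q,
    universal n [:: a] [:: b] cs cq s q <-> holds phi (tuple_of_env m (env s q)).
Proof.
elim: n m phi => [|n IH] m phi phin.
  case: phi phin => {m} [m phi _|//].
  have [D [N [mN Dphi phiD]]] := has_dnf_qformula phi true (leqnn m).
  have [s1 [s2 [e DP]]] := dnf_trueP D.
  exists (nth [::] [:: s1; s2; e; run m]) => cs cq code s q.
  have c0 : beta [:: b] cs cq [::] = s1 := esym (code 0 isT).
  have c1 : beta [:: b] cs cq [:: a] = s2 := esym (code 1 isT).
  have c2 : beta [:: b] cs cq ([:: a] ++ [:: a]) = e := esym (code 2 isT).
  have c3 : beta [:: b] cs cq (pow [:: a] 3) = run m := esym (code 3 isT).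
  rewrite /universal c0 c1 c2 c3; split.
    move=> [_ [s' [q' [<- [/agreeP E]]]]] [_ [_ [_ [<- [<- [<- /DP/Dphi]]]]]].
    by rewrite (eq_tuple_of_env E).
  move=> /phiD[f' ff' f'D].
  (* The pair chosen here also stores the auxiliary variables of the normal form. *)
  have [s' [q' E]] := env_surj (maxn m N) f'.
  exists (run m), s', q'; split=> //; split.
    by apply/agreeP => j jm; rewrite E ?ff' // leq_max jm.
  exists s1, s2, e; do 3!split=> //; apply/DP/f'D => j jN.
  by rewrite E // leq_max jN orbT.
have [m' [psi [mm' psin phiE]]] := first_block phin.
have [|g gP] := IH _ (neg psi); first by rewrite sigma_neg.
(* The code of the remainder occupies the positions below [n.+4]; the next one records [m]. *)
exists (update g n.+4 (run m)) => cs cq code s q.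
have gcode : agree_below n.+4 g (env cs cq).
  apply: agree_below_trans (agree_belowW (leqnSn _) code).
  exact: agree_below_update.
have c : beta [:: b] cs cq (pow [:: a] n.+4) = run m.
  by rewrite powE -[LHS]/(env cs cq n.+4) -code // /update eqxx.
rewrite phiE /= -/(pow [:: a] n.+4) c; split.
  move=> [_ [s' [q' [<- [/agreeP E]]]]]; rewrite (gP _ _ gcode) holds_neg notK => H.
  by exists (env s' q') => // j jm; rewrite E.
move=> [f' ff' H]; have [s' [q' E]] := env_surj m' f'.
exists (run m), s', q'; split=> //; split.
  by apply/agreeP => j jm; rewrite E ?ff' //; apply: leq_trans mm'.
by rewrite (gP _ _ gcode) holds_neg notK (eq_tuple_of_env E).
Qed.

(** Evaluate [phi] at its own code [(cs, cq)]. The letters are arguments too, as the language has no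
    constants for them. *)
Lemma diagonal_not_sigma n (phi : prenex monoid_language 4) : sigma_formula n phi ->
  ~ forall v, holds phi v <-> diagonal n (word_of (tnth v (inord 0)))
      (word_of (tnth v (inord 1))) (word_of (tnth v (inord 2)))
      (word_of (tnth v (inord 3))).
Proof.
move=> phin phiE; have [g gP] := universalP phin.
have [cs [cq code]] := env_surj n.+4 g.
(* The list is reversed because x_i is stored at position 3 - i. *)
pose f := nth [::] [:: cq; cs; [:: b]; [:: a]].
have {}gP := gP cs cq (agree_below_sym code).
have := phiE (tuple_of_env 4 f); rewrite !tnth_mktuple !inordK //= => phif.
have fE s q : agree_below 4 f (env s q) ->
    universal n [:: a] [:: b] cs cq s q <-> holds phi (tuple_of_env 4 f).
  by move=> fsq; rewrite gP (eq_tuple_of_env fsq).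
(* If [phi] holds, the pair given by [diagonal] stores [f] and refutes [universal], against [fE]; if
   not, any pair storing [f] witnesses [diagonal]. *)
have [H|H] := pselect (holds phi (tuple_of_env 4 f)).
  have [s [q [[c3 [c2 [c1 c0]]]]]] := phif.1 H; apply; apply/fE => //.
  by move=> [|[|[|[|j]]]] // _; rewrite /f /env /= ?c0 ?c1 ?c2 ?c3.
have [s [q E]] := env_surj 4 f.
apply/H/phif; exists s, q; split; last by rewrite fE //; apply: agree_below_sym.
by split; [apply: (E 3)|split; [apply: (E 2)|split; [apply: (E 1)|apply: (E 0)]]].
Qed.

End Coding.

Lemma sigma_neq (a b : X) n : a != b -> Sigma M n <> Sigma M n.+1.
Proof.
move=> ab coll.
have [phi phiE] : definable (fun v : 4.-tuple M =>
    diagonal n (word_of (tnth v (inord 0))) (word_of (tnth v (inord 1)))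
      (word_of (tnth v (inord 2))) (word_of (tnth v (inord 3)))).
  by apply: definable_diagonal; apply: definable_word_var.
have [psi psin E] := collapse_sigma (@monalg.FMonom X [::] : M) coll phi.
by apply: (diagonal_not_sigma ab psin) => v; rewrite -E phiE.
Qed.

End Definability.

Theorem corollary6 (X : finType) (hX : 2 <= #|X|) :
  hierarchy_proper (free_monoid X) /\
  (forall n : nat, Sigma (free_monoid X) n <> Sigma (free_monoid X) n.+1).
Proof.
have [a [b [_ _ ab]]] := card_gt1P hX.
by split=> [[n]|n]; apply: (sigma_neq ab).
Qed.
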